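(* Let $E,A\in\mathbb{R}^{\ell\times n}$, $B\in\mathbb{R}^{\ell\times m}$, and let $\mathcal{V}^*:=\mathcal{V}^*_{[E,A,B]}$, $\mathcal{W}^*:=\mathcal{W}^*_{[E,A,B]}$ be the augmented Wong limits of $[E,A,B]$. Choose full column rank matrices $U_T\in\mathbb{R}^{n\times n_1}$, $R_T\in\mathbb{R}^{n\times n_2}$, $O_T\in\mathbb{R}^{n\times n_3}$, $U_S\in\mathbb{R}^{\ell\times \ell_1}$, $R_S\in\mathbb{R}^{\ell\times \ell_2}$, $O_S\in\mathbb{R}^{\ell\times \ell_3}$ such that $$\operatorname{im} U_T=\mathcal{V}^*\cap\mathcal{W}^*,\qquad \operatorname{im} R_T\oplus\operatorname{im} U_T=\mathcal{V}^*,\qquad \operatorname{im} O_T\oplus\operatorname{im} R_T\oplus\operatorname{im} U_T=\mathbb{R}^n,$$ $$\operatorname{im} U_S=E\mathcal{V}^*\cap(A\mathcal{W}^*+\operatorname{im} B),\qquad \operatorname{im} R_S\oplus\operatorname{im} U_S=E\mathcal{V}^*,\qquad \operatorname{im} O_S\oplus\operatorname{im} R_S\oplus\operatorname{im} U_S=\mathbb{R}^\ell,$$ and, additionally, $\operatorname{im} B\subseteq\operatorname{im}[U_S,O_S]$. Let $T:=[U_T,R_T,O_T]$ and $S:=[U_S,R_S,O_S]^{-1}$. Further choose (not necessarily full rank) matrices $F_1\in\mathbb{R}^{m\times n_1}$, $F_2\in\mathbb{R}^{m\times n_2}$ such that $$[0,I_{\ell_2+\ell_3}]\,S\,(AU_T+BF_1)=0\qquad\text{and}\qquad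 [0,0,I_{\ell_3}]\,S\,(AR_T+BF_2)=0,$$ and let $F_P:=[F_1,F_2,0]\in\mathbb{R}^{m\times n}$. Finally, let $V=[V_1,V_2,V_3]$, where $V_1,V_2,V_3$ are full column rank matrices with $\operatorname{im} V_1\oplus\operatorname{im} V_2\oplus\operatorname{im} V_3=\mathbb{R}^m$ such that $$\operatorname{im} V_2=\ker B\qquad\text{and}\qquad \operatorname{im}[V_1,V_2]=\ker\big([0,0,I_{\ell_3}]\,S\,B\big).$$ Then $[SET,\;S(AT+BF_P),\;SBV]$ is in quasi P-feedback form (QPFF), with block sizes $\ell_1,\ell_2,\ell_3$; $n_1,n_2,n_3$; and $m_1,m_2,m_3$ (the numbers of columns of $V_1,V_2,V_3$).
   Context: $\Sigma_{\ell,n,m}$ is the set of triples $[E,A,B]$ with $E,A\in\mathbb{R}^{\ell\times n}$, $B\in\mathbb{R}^{\ell\times m}$. Augmented Wong sequences: for $[E,A,B]\in\Sigma_{\ell,n,m}$ put $\mathcal{V}^0_{[E,A,B]}:=\mathbb{R}^n$, $\mathcal{V}^{i+1}_{[E,A,B]}:=A^{-1}(E\mathcal{V}^i_{[E,A,B]}+\operatorname{im} B)$ and $\mathcal{W}^0_{[E,A,B]}:=\{0\}$, $\mathcal{W}^{i+1}_{[E,A,B]}:=E^{-1}(A\mathcal{W}^i_{[E,A,B]}+\operatorname{im} B)$, where $A^{-1}(\cdot)$, $E^{-1}(\cdot)$ denote preimages of subspaces under the linear maps $A,E:\mathbb{R}^n\to\mathbb{R}^\ell$. The augmented Wong limits are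 $\mathcal{V}^*_{[E,A,B]}:=\bigcap_{i\ge 0}\mathcal{V}^i_{[E,A,B]}$ and $\mathcal{W}^*_{[E,A,B]}:=\bigcup_{i\ge 0}\mathcal{W}^i_{[E,A,B]}$ (both are linear subspaces of $\mathbb{R}^n$). Quasi P-feedback form (QPFF): a triple $[E,A,B]\in\Sigma_{\ell,n,m}$ is in QPFF if $$E=\begin{bmatrix}E_{11}&E_{12}&E_{13}\\0&E_{22}&E_{23}\\0&0&E_{33}\end{bmatrix},\quad A=\begin{bmatrix}A_{11}&A_{12}&A_{13}\\0&A_{22}&A_{23}\\0&0&A_{33}\end{bmatrix},\quad B=\begin{bmatrix}B_{11}&0&B_{13}\\0&0&0\\0&0&B_{33}\end{bmatrix}$$ with row block sizes $\ell_1,\ell_2,\ell_3$, column block sizes $n_1,n_2,n_3$ (for $E,A$) and $m_1,m_2,m_3$ (for $B$), where (i) $E_{11},A_{11}\in\mathbb{R}^{\ell_1\times n_1}$, $B_{11}\in\mathbb{R}^{\ell_1\times m_1}$, $\ell_1<n_1+m_1$, $\operatorname{rk}E_{11}=\operatorname{rk}_{\mathbb{C}}[\lambda E_{11}-A_{11},B_{11}]=\ell_1$ for all $\lambda\in\mathbb{C}$, and $\operatorname{rk}B_{11}=m_1$; (ii) $E_{22},A_{22}\in\mathbb{R}^{\ell_2\times n_2}$ with $\ell_2=n_2$ and $E_{22}$ invertible; (iii) $E_{33},A_{33}\in\mathbb{R}^{\ell_3\times n_3}$, $B_{33}\in\mathbb{R}^{\ell_3\times m_3}$ with $\operatorname{rk}_{\mathbb{C}}[\lambda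 E_{33}-A_{33},B_{33}]=n_3+m_3$ for all $\lambda\in\mathbb{C}$. The remaining matrices have suitable sizes. Blocks may be empty (any of the sizes may be $0$); if the first block is void, i.e. $\ell_1=n_1=m_1=0$, the strict inequality $\ell_1<n_1+m_1$ is not required. *)

(* Defs.v *)
From HB Require Import structures.
From mathcomp Require Import all_boot all_order all_algebra.
From mathcomp Require Import boolp reals.
From mathcomp Require Import complex.
From mathcomp Require Import zify.

Set Implicit Arguments.
Unset Strict Implicit.
Unset Printing Implicit Defensive.

Import Order.TTheory GRing.Theory Num.Theory.
Local Open Scope ring_scope.

(* Matrices act on column vectors, x |-> M *m x, as in the source, so that
   images, kernels and Wong subspaces are subspaces of 'cV_n. *)
Definition lmx (F : fieldType) (p q : nat) (M : 'M[F]_(p, q)) :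
  'Hom('cV[F]_q, 'cV[F]_p) := linfun (mulmx M).

Notation im M := (limg (lmx M)).
Notation ker M := (lker (lmx M)).

Lemma lmxE (F : fieldType) (p q : nat) (M : 'M[F]_(p, q)) x : lmx M x = M *m x.
Proof. by rewrite lfunE. Qed.

Definition full_col_rank (F : fieldType) (p q : nat) (M : 'M[F]_(p, q)) : Prop :=
  \rank M = q.

(* The two dimensions are allowed to differ syntactically; an inverse pair
   forces p = q, and N is then the inverse of M. *)
Definition is_inverse (F : fieldType) (p q : nat)
    (M : 'M[F]_(p, q)) (N : 'M[F]_(q, p)) : Prop :=
  M *m N = 1%:M /\ N *m M = 1%:M.

Definition block3 (F : fieldType) (p1 p2 p3 q1 q2 q3 : nat)
    (M11 : 'M[F]_(p1, q1)) (M12 : 'M[F]_(p1, q2)) (M13 : 'M[F]_(p1, q3))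
    (M21 : 'M[F]_(p2, q1)) (M22 : 'M[F]_(p2, q2)) (M23 : 'M[F]_(p2, q3))
    (M31 : 'M[F]_(p3, q1)) (M32 : 'M[F]_(p3, q2)) (M33 : 'M[F]_(p3, q3)) :
    'M[F]_(p1 + (p2 + p3), q1 + (q2 + q3)) :=
  col_mx (row_mx M11 (row_mx M12 M13))
    (col_mx (row_mx M21 (row_mx M22 M23))
            (row_mx M31 (row_mx M32 M33))).

Section FamiliesOfSubspaces.
Variables (F : fieldType) (vT : vectType F).

Lemma bigcapv_nat_ex (V : nat -> {vspace vT}) :
  exists U : {vspace vT}, forall x, x \in U <-> forall i, x \in V i.
Proof.
pose I k := (\bigcap_(i < k) V i)%VS.
have IP k x : reflect (forall i, (i < k)%N -> x \in V i) (x \in I k).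
  rewrite memvE; apply: (iffP subv_bigcapP) => H.
    by move=> i ik; rewrite memvE; exact: (H (Ordinal ik)).
  by move=> i _; rewrite -memvE; apply: H.
have sI j k : (j <= k)%N -> (I k <= I j)%VS.
  move=> jk; apply/subvP => x /IP H; apply/IP => i ij.
  by apply: H; apply: leq_trans jk.
suff H d k : (\dim (I k) <= d)%N ->
    exists U : {vspace vT}, forall x, x \in U <-> forall i, x \in V i.
  exact: (H _ 0%N (leqnn _)).
elim: d k => [|d IHd] k dk.
  exists (I k) => x; split=> [xk i|H]; last by apply/IP => i _.
  move: dk; rewrite leqn0 dimv_eq0 => /eqP Ik0.
  by move: xk; rewrite Ik0 memv0 => /eqP ->; rewrite mem0v.
have [[j [kj jd]]|H] := pselect (exists j, (k <= j)%N /\ (\dim (I j) <= d)%N).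
  exact: IHd jd.
exists (I k) => x; split=> [xk i|Hx]; last by apply/IP => i _.
have ki : (k <= maxn k i.+1)%N by rewrite leq_maxl.
suff E : I (maxn k i.+1) = I k.
  by move: xk; rewrite -E => /IP; apply; rewrite leq_max ltnSn orbT.
apply/eqP; rewrite eqEdim sI //= (leq_trans dk) // ltnNge.
by apply/negP => H'; apply: H; exists (maxn k i.+1).
Qed.

Lemma bigcupv_nat_ex (W : nat -> {vspace vT}) :
  (forall i, W i <= W i.+1)%VS ->
  exists U : {vspace vT}, forall x, x \in U <-> exists i, x \in W i.
Proof.
move=> WS.
have sW j k : (j <= k)%N -> (W j <= W k)%VS.
  elim: k => [|k IHk]; first by rewrite leqn0 => /eqP ->.
  rewrite leq_eqVlt => /predU1P[-> //|/IHk H].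
  exact: subv_trans H (WS k).
suff H d k : (\dim {:vT} - \dim (W k) <= d)%N ->
    exists U : {vspace vT}, forall x, x \in U <-> exists i, x \in W i.
  exact: (H _ 0%N (leqnn _)).
have dW i : (\dim (W i) <= \dim {:vT})%N by rewrite dimvS ?subvf.
elim: d k => [|d IHd] k dk.
  exists (W k) => x; split=> [xk|[i xi]]; first by exists k.
  have /eqP -> : W k == fullv.
    by rewrite eqEdim subvf /= -subn_eq0 -leqn0.
  exact: memvf.
have [[j jd]|H] := pselect (exists j, (\dim {:vT} - \dim (W j) <= d)%N).
  exact: IHd jd.
exists (W k) => x; split=> [xk|[i xi]]; first by exists k.
have /eqP -> : W k == W (maxn k i).
  rewrite eqEdim sW ?leq_maxl //=.
  have : (d < \dim {:vT} - \dim (W (maxn k i)))%N.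
    by rewrite ltnNge; apply/negP => H'; apply: H; exists (maxn k i).
  move: dk (dW k) (dW (maxn k i)).
  move: (\dim _) (\dim _) (\dim _) => D a b; lia.
by apply: subvP xi; rewrite sW ?leq_maxr.
Qed.

End FamiliesOfSubspaces.

Section AugmentedWongSequences.
Variables (F : fieldType) (l n m : nat).
Variables (E A : 'M[F]_(l, n)) (B : 'M[F]_(l, m)).

Fixpoint wongV (i : nat) : {vspace 'cV[F]_n} :=
  if i is j.+1 then (lmx A @^-1: (lmx E @: wongV j + im B))%VS else fullv.

Fixpoint wongW (i : nat) : {vspace 'cV[F]_n} :=
  if i is j.+1 then (lmx E @^-1: (lmx A @: wongW j + im B))%VS else 0%VS.

Lemma wongW_incr i : (wongW i <= wongW i.+1)%VS.
Proof.
elim: i => [|i IHi]; first exact: sub0v.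
by apply: lpreimS; apply: addvS => //; apply: limgS.
Qed.

(* The infinite intersection (union) of the sequence as a subspace; it is
   determined by its elements, see memVlim (memWlim). *)
Definition wongVlim : {vspace 'cV[F]_n} := sval (cid (bigcapv_nat_ex wongV)).

Definition wongWlim : {vspace 'cV[F]_n} :=
  sval (cid (bigcupv_nat_ex wongW_incr)).

Lemma memVlim x : x \in wongVlim <-> forall i, x \in wongV i.
Proof. exact: (svalP (cid (bigcapv_nat_ex wongV))). Qed.

Lemma memWlim x : x \in wongWlim <-> exists i, x \in wongW i.
Proof. exact: (svalP (cid (bigcupv_nat_ex wongW_incr))). Qed.

End AugmentedWongSequences.

(* The pencil [lambda E - A, B] over the complex numbers. *)
Definition pencil (R : realType) (l n m : nat) (E A : 'M[R]_(l, n))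
    (B : 'M[R]_(l, m)) (lambda : R[i]) : 'M[R[i]]_(l, n + m) :=
  row_mx (lambda *: map_mx (real_complex R) E - map_mx (real_complex R) A)
         (map_mx (real_complex R) B).

(* All block sizes may be 0; the strict inequality in QPFF1 is only waived when
   the whole first block is void. *)
Definition QPFF1 (R : realType) (l1 n1 m1 : nat)
    (E11 A11 : 'M[R]_(l1, n1)) (B11 : 'M[R]_(l1, m1)) : Prop :=
  [/\ [/\ l1 = 0, n1 = 0 & m1 = 0]%N \/ (l1 < n1 + m1)%N,
      \rank E11 = l1,
      forall lambda : R[i], \rank (pencil E11 A11 B11 lambda) = l1
    & \rank B11 = m1].

Definition QPFF2 (R : realType) (l2 n2 : nat) (E22 : 'M[R]_(l2, n2)) : Prop :=
  l2 = n2 /\ exists E22inv : 'M[R]_(n2, l2), is_inverse E22inv E22.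

Definition QPFF3 (R : realType) (l3 n3 m3 : nat)
    (E33 A33 : 'M[R]_(l3, n3)) (B33 : 'M[R]_(l3, m3)) : Prop :=
  forall lambda : R[i], \rank (pencil E33 A33 B33 lambda) = (n3 + m3)%N.

Definition QPFF (R : realType) (l1 l2 l3 n1 n2 n3 m1 m2 m3 : nat)
    (E A : 'M[R]_(l1 + (l2 + l3), n1 + (n2 + n3)))
    (B : 'M[R]_(l1 + (l2 + l3), m1 + (m2 + m3))) : Prop :=
  exists (E11 A11 : 'M[R]_(l1, n1)) (E12 A12 : 'M[R]_(l1, n2))
         (E13 A13 : 'M[R]_(l1, n3)) (E22 A22 : 'M[R]_(l2, n2))
         (E23 A23 : 'M[R]_(l2, n3)) (E33 A33 : 'M[R]_(l3, n3))
         (B11 : 'M[R]_(l1, m1)) (B13 : 'M[R]_(l1, m3)) (B33 : 'M[R]_(l3, m3)),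
    [/\ E = block3 E11 E12 E13
                   0   E22 E23
                   0   0   E33,
        A = block3 A11 A12 A13
                   0   A22 A23
                   0   0   A33
      & B = block3 B11 0   B13
                   0   (0 : 'M[R]_(l2, m2)) 0
                   0   0   B33]
    /\ [/\ QPFF1 E11 A11 B11, QPFF2 E22 & QPFF3 E33 A33 B33].

(* Main.v *)
Require Import Defs.
From HB Require Import structures.
From mathcomp Require Import all_boot all_order all_algebra.
From mathcomp Require Import boolp reals.
From mathcomp Require Import complex.

Set Implicit Arguments.
Unset Strict Implicit.
Unset Printing Implicit Defensive.

Import Order.TTheory GRing.Theory Num.Theory.
Local Open Scope ring_scope.

(* Write V and W for the augmented Wong limits.  Block triangularity comes from
   im [U_S, R_S] = E V and im U_S = E (V :&: W).  The rank conditions on the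
   pencils are read off the Wong limits of the diagonal blocks: for the first
   block, a restriction to V :&: W, the limit of the W-sequence is the whole
   space, on which a complex left null vector of the pencil would vanish; for the
   third block, a quotient by V, the limit of the V-sequence is 0, whereas it
   contains the real and imaginary parts of the null vectors of the pencil. *)

(** * Images, kernels and ranks of matrices acting on columns *)

Section MatrixMaps.
Variable F : fieldType.

Lemma memv_limgP p q (M : 'M[F]_(p, q)) x :
  reflect (exists y, x = M *m y) (x \in im M).
Proof.
apply: (iffP memv_imgP) => [[y _ ->]|[y ->]].
  by exists y; rewrite lmxE.
by exists y; rewrite ?memvf ?lmxE.
Qed.

Lemma memv_lmx_imgP p q (M : 'M[F]_(p, q)) (U : {vspace 'cV[F]_q}) x :
  reflect (exists2 y, y \in U & x = M *m y) (x \in (lmx M @: U)%VS).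
Proof.
by apply: (iffP memv_imgP) => -[y Uy ->]; exists y; rewrite ?lmxE.
Qed.

Lemma memv_lmx_kerP p q (M : 'M[F]_(p, q)) x :
  reflect (M *m x = 0) (x \in ker M).
Proof. by rewrite memv_ker lmxE; apply: eqP. Qed.

Lemma limg_row_mx p q1 q2 (M : 'M[F]_(p, q1)) (N : 'M[F]_(p, q2)) :
  im (row_mx M N) = (im M + im N)%VS.
Proof.
apply/vspaceP => x; apply/memv_limgP/memv_addP => [[y ->]|].
  exists (M *m usubmx y); first by apply/memv_limgP; exists (usubmx y).
  exists (N *m dsubmx y); first by apply/memv_limgP; exists (dsubmx y).
  by rewrite -mul_row_col vsubmxK.
case=> _ /memv_limgP[a ->] [_ /memv_limgP[b ->] ->].
by exists (col_mx a b); rewrite mul_row_col.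
Qed.

Lemma mulmx_cV_eq0 p q (M : 'M[F]_(p, q)) :
  (forall x : 'cV_q, M *m x = 0) -> M = 0.
Proof.
move=> M0; apply/matrixP => i j.
have /matrixP/(_ i 0) := M0 (delta_mx j 0).
by rewrite -colE !mxE.
Qed.

Lemma mulmx_inj_rank p q (M : 'M[F]_(p, q)) :
  (forall x : 'cV_q, M *m x = 0 -> x = 0) -> \rank M = q.
Proof.
move=> injM; apply/eqP; rewrite -mxrank_tr; apply/inj_row_free => v vM0.
by apply: trmx_inj; rewrite trmx0; apply: injM; rewrite -[M]trmxK -trmx_mul vM0 trmx0.
Qed.

Lemma full_col_rank_inj p q (M : 'M[F]_(p, q)) (x : 'cV_q) :
  full_col_rank M -> M *m x = 0 -> x = 0.
Proof.
move=> /eqP/row_fullP[N NM] Mx0.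
by rewrite -[x]mul1mx -NM -mulmxA Mx0 mulmx0.
Qed.

Lemma mulmx_surj_rank p q (M : 'M[F]_(p, q)) :
  (forall y : 'cV_p, exists x, M *m x = y) -> \rank M = p.
Proof.
move=> surjM; apply/eqP/inj_row_free => z zM0; apply: mulmx_cV_eq0 => y.
by have [x <-] := surjM y; rewrite mulmxA zM0 mul0mx.
Qed.

End MatrixMaps.

Lemma memv_cap0 (K : fieldType) (vT : vectType K) (U W : {vspace vT}) x :
  (U :&: W)%VS = 0%VS -> x \in U -> x \in W -> x = 0.
Proof. by move=> UW0 Ux Wx; apply/eqP; rewrite -memv0 -UW0 memv_cap Ux Wx. Qed.

(** * Fixed-point characterisations of the augmented Wong limits *)

Section WongLimits.
Variables (F : fieldType) (l n m : nat).
Variables (E A : 'M[F]_(l, n)) (B : 'M[F]_(l, m)).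

Lemma mem_wongVS i x :
  x \in wongV E A B i.+1 <->
  exists v u, v \in wongV E A B i /\ A *m x = E *m v + B *m u.
Proof.
rewrite /= -memv_preim lmxE; split.
  case/memv_addP => _ /memv_lmx_imgP[v Vv ->] [_ /memv_limgP[u ->] ->].
  by exists v, u.
case=> v [u [Vv ->]]; apply: memv_add; last by apply/memv_limgP; exists u.
by apply/memv_lmx_imgP; exists v.
Qed.

Lemma mem_wongWS i x :
  x \in wongW E A B i.+1 <->
  exists w u, w \in wongW E A B i /\ E *m x = A *m w + B *m u.
Proof.
rewrite /= -memv_preim lmxE; split.
  case/memv_addP => _ /memv_lmx_imgP[v Vv ->] [_ /memv_limgP[u ->] ->].
  by exists v, u.
case=> v [u [Vv ->]]; apply: memv_add; last by apply/memv_limgP; exists u.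
by apply/memv_lmx_imgP; exists v.
Qed.

Lemma wongV_decr i : (wongV E A B i.+1 <= wongV E A B i)%VS.
Proof.
elim: i => [|i IHi]; first exact: subvf.
by apply: lpreimS; apply: addvS => //; apply: limgS.
Qed.

(** Dimensions cannot drop forever, so two consecutive terms agree at some [N]. The recursion step
    is monotone, which carries [V^N <= V^i] over to [V^N = V^(N+1) <= V^(i+1)]. *)
Lemma wongV_stationary : exists N, forall i, (wongV E A B N <= wongV E A B i)%VS.
Proof.
have [N VN] : exists N, wongV E A B N.+1 = wongV E A B N.
  suff H d i : (\dim (wongV E A B i) <= d)%N ->
      exists N, wongV E A B N.+1 = wongV E A B N by exact: (H _ 0%N (leqnn _)).
  elim: d i => [|d IHd] i di; have [/eqP|] := eqVneq (wongV E A B i.+1) (wongV E A B i).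
  - by exists i; apply/eqP.
  - by rewrite eqEdim wongV_decr (leq_trans di).
  - by exists i; apply/eqP.
  rewrite eqEdim wongV_decr /= -ltnNge => lt_i.
  by apply: (IHd i.+1); rewrite -ltnS (leq_trans lt_i).
exists N; elim=> [|i IHi]; first exact: subvf.
by rewrite -VN; apply: lpreimS; apply: addvS => //; apply: limgS.
Qed.

(** The witness [v] supplied by stage [i+1] depends on [i]; at a stationary index a single [v] lies
    in all terms at once. *)
Lemma mem_wongVlim_fix x :
  x \in wongVlim E A B <->
  exists v u, v \in wongVlim E A B /\ A *m x = E *m v + B *m u.
Proof.
split=> [/memVlim Vx|[v [u [/memVlim Vv Ax]]]].
  have [N sN] := wongV_stationary.
  have /mem_wongVS[v [u [Vv Ax]]] := Vx N.+1.
  by exists v, u; split=> //; apply/memVlim => i; apply: subvP Vv.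
apply/memVlim => -[|i]; first exact: memvf.
by apply/mem_wongVS; exists v, u.
Qed.

Lemma mem_wongWlim_fix x :
  x \in wongWlim E A B <->
  exists w u, w \in wongWlim E A B /\ E *m x = A *m w + B *m u.
Proof.
split=> [/memWlim[[|i]]|[w [u [/memWlim[i Ww] Ex]]]].
- by rewrite memv0 => /eqP->; exists 0, 0; rewrite mem0v !mulmx0 addr0.
- case/mem_wongWS=> w [u [Ww Ex]]; exists w, u; split=> //.
  by apply/memWlim; exists i.
by apply/memWlim; exists i.+1; apply/mem_wongWS; exists w, u.
Qed.

(** Membership in the union is reached after finitely many steps from 0, so a property that survives
    one step holds on the limit. *)
Lemma wongWlim_ind (P : 'cV[F]_n -> Prop) :
  P 0 ->
  (forall w x u, P w -> E *m x = A *m w + B *m u -> P x) ->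
  forall x, x \in wongWlim E A B -> P x.
Proof.
move=> P0 PS x Wx; case: ((memWlim E A B x).1 Wx) => i {Wx}; elim: i x => [|i IHi] x.
  by rewrite memv0 => /eqP->.
by case/mem_wongWS=> w [u [/IHi Pw Ex]]; apply: PS Pw Ex.
Qed.

End WongLimits.

(** * Rank conditions on pencils from Wong limits *)

Section QPFFBlocks.
Variable R : realType.

(* A left null vector z of the pencil at lambda satisfies
   z E x = z A w = lambda z E w whenever E x = A w + B u, so z E vanishes along
   the whole sequence W^i. *)
Lemma QPFF1_of_wongWlim l n m (E A : 'M[R]_(l, n)) (B : 'M[R]_(l, m)) :
  \rank E = l -> \rank B = m -> wongWlim E A B = fullv -> QPFF1 E A B.
Proof.
move=> rE rB Wfull; split=> //.
  (* If [n + m <= l], then [l = \rank E <= n] forces [m = 0] and [l = n]. Now [E] is injective and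
     there is no input, so the W-sequence never leaves 0; as its limit is everything, [n = 0]. *)
  case: (ltnP l (n + m)) => [|nml]; [by right | left].
  have ln : (l <= n)%N by rewrite -rE rank_leq_col.
  have m0 : m = 0%N.
    by apply/eqP; rewrite -leqn0 -(leq_add2l n) addn0 (leq_trans nml).
  have nl : l = n.
    by apply/eqP; rewrite eqn_leq ln (leq_trans _ nml) ?leq_addr.
  suff n0 : n = 0%N by rewrite nl n0.
  have full x : x = 0 :> 'cV[R]_n.
    have := memvf x; rewrite -Wfull; move: x; apply: wongWlim_ind => //.
    move=> w x u -> Ex; apply: (@full_col_rank_inj _ _ _ E); first by rewrite /full_col_rank rE.
    rewrite Ex mulmx0 add0r; move: B u {rB Wfull Ex}; rewrite m0 => B' u.
    by rewrite [u]flatmx0 mulmx0.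
  case: (posnP n) => // n_gt0.
  have /matrixP/(_ (Ordinal n_gt0) 0) := full (const_mx 1).
  by rewrite !mxE => /eqP; rewrite oner_eq0.
move=> lambda; apply/eqP/inj_row_free => z.
rewrite /pencil mul_mx_row -[0]row_mx0 => /eq_row_mx[].
rewrite mulmxBr -scalemxAr => /eqP; rewrite subr_eq0 => /eqP zE zB.
pose toC p q (M : 'M[R]_(p, q)) := map_mx (real_complex R) M.
have zEx (x : 'cV_n) : z *m toC _ _ E *m toC _ _ x = 0.
  have := memvf x; rewrite -Wfull; move: x; apply: wongWlim_ind.
    by rewrite /toC map_mx0 mulmx0.
  move=> w x u zEw Ex.
  rewrite -mulmxA /toC -map_mxM Ex map_mxD !map_mxM mulmxDr !mulmxA zB mul0mx.
  by rewrite -zE -scalemxAl zEw scaler0 addr0.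
have zE0 : z *m toC _ _ E = 0.
  apply/matrixP => i j; have /matrixP/(_ i 0) := zEx (delta_mx j 0).
  by rewrite /toC map_delta_mx -colE !mxE.
have /row_freeP[E' EE'] : row_free E by rewrite /row_free rE.
by rewrite -[z]mulmx1 -(map_mx1 (real_complex R)) -EE' map_mxM mulmxA zE0 mul0mx.
Qed.

(** As [M] is real, no parts mix; with its companion for [Im] this turns a complex null vector of
    the pencil into real relations. *)
Lemma Re_mulmx p q (M : 'M[R]_(p, q)) r (x : 'M[R[i]]_(q, r)) :
  map_mx (@complex.Re R) (map_mx (real_complex R) M *m x) =
  M *m map_mx (@complex.Re R) x.
Proof.
apply/matrixP => i j; rewrite !mxE.
rewrite (big_morph (@complex.Re R) (id1 := 0) (op1 := +%R)) //; last by case=> ? ? [].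
by apply: eq_bigr => k _; rewrite !mxE; case: (x k j) => a b /=; rewrite mul0r subr0.
Qed.

Lemma Im_mulmx p q (M : 'M[R]_(p, q)) r (x : 'M[R[i]]_(q, r)) :
  map_mx (@complex.Im R) (map_mx (real_complex R) M *m x) =
  M *m map_mx (@complex.Im R) x.
Proof.
apply/matrixP => i j; rewrite !mxE.
rewrite (big_morph (@complex.Im R) (id1 := 0) (op1 := +%R)) //; last by case=> ? ? [].
by apply: eq_bigr => k _; rewrite !mxE; case: (x k j) => a b /=; rewrite mul0r addr0.
Qed.

Lemma QPFF3_of_wongVlim l n m (E A : 'M[R]_(l, n)) (B : 'M[R]_(l, m)) :
  \rank B = m -> wongVlim E A B = 0%VS -> QPFF3 E A B.
Proof.
move=> rB V0 [s t]; apply: mulmx_inj_rank => xu.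
rewrite -[xu]vsubmxK /pencil mul_row_col.
move: (usubmx xu) (dsubmx xu) => x u {xu} pxu.
pose re p (y : 'cV[R[i]]_p) := map_mx (@complex.Re R) y.
pose iM p (y : 'cV[R[i]]_p) := map_mx (@complex.Im R) y.
(* Real and imaginary parts of [A x = lambda E x + B u] at [lambda = s + i t]. *)
have [Are Aim] :
    A *m re _ x = E *m (s *: re _ x - t *: iM _ x) + B *m re _ u /\
    A *m iM _ x = E *m (t *: re _ x + s *: iM _ x) + B *m iM _ u.
  have {pxu} Ax : map_mx (real_complex R) A *m x
      = map_mx (real_complex R) E *m ((s +i* t)%C *: x) + map_mx (real_complex R) B *m u.
    apply/eqP; rewrite eq_sym -subr_eq0 -pxu mulmxBl -scalemxAl -scalemxAr.
    by rewrite addrAC.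
  have reD p (y z : 'cV_p) : re _ (y + z) = re _ y + re _ z.
    by apply/matrixP => i j; rewrite !mxE; case: (y i j) (z i j) => [? ?] [].
  have iMD p (y z : 'cV_p) : iM _ (y + z) = iM _ y + iM _ z.
    by apply/matrixP => i j; rewrite !mxE; case: (y i j) (z i j) => [? ?] [].
  split.
    rewrite -!Re_mulmx Ax [LHS]reD; congr (_ + _); rewrite [LHS]Re_mulmx.
    by congr mulmx; apply/matrixP => i j; rewrite !mxE; case: (x i j).
  rewrite -!Im_mulmx Ax [LHS]iMD; congr (_ + _); rewrite [LHS]Im_mulmx.
  by congr mulmx; apply/matrixP => i j; rewrite !mxE addrC; case: (x i j).
have {Are Aim} [/memVlim Vre /memVlim Vim] :
    re _ x \in wongVlim E A B /\ iM _ x \in wongVlim E A B.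
  (* Both parts are carried through one induction, since each relation has both of them under
     [E]. *)
  suff H i : re _ x \in wongV E A B i /\ iM _ x \in wongV E A B i.
    by split; apply/memVlim => i; case: (H i).
  elim: i => [|i [Vre Vim]]; first by rewrite !memvf.
  split; apply/mem_wongVS; do 2 eexists; (split; last by [exact: Are | exact: Aim]).
    by apply: memvB; apply: memvZ.
  by apply: memvD; apply: memvZ.
have x0 : x = 0.
  have /eqP re0 : re _ x == 0 by rewrite -memv0 -V0; apply/memVlim.
  have /eqP im0 : iM _ x == 0 by rewrite -memv0 -V0; apply/memVlim.
  apply/matrixP => i j; move/matrixP/(_ i j): re0; move/matrixP/(_ i j): im0.
  by rewrite !mxE; case: (x i j) => a b /= -> ->.
move: pxu; rewrite x0 mulmx0 add0r => Bu0.
suff -> : u = 0 by rewrite col_mx0.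
have /row_fullP[B' B'B] : row_full B by apply/eqP.
by rewrite -[u]mul1mx -(map_mx1 (real_complex R)) -B'B map_mxM -mulmxA Bu0 mulmx0.
Qed.

End QPFFBlocks.

(** * The quasi P-feedback form of the transformed triple *)

Theorem theorem3p12 (R : realType) (l n m : nat)
  (E A : 'M[R]_(l, n)) (B : 'M[R]_(l, m))
  (l1 l2 l3 n1 n2 n3 m1 m2 m3 : nat)
  (UT : 'M[R]_(n, n1)) (RT : 'M[R]_(n, n2)) (OT : 'M[R]_(n, n3))
  (US : 'M[R]_(l, l1)) (RS : 'M[R]_(l, l2)) (OS : 'M[R]_(l, l3))
  (S : 'M[R]_(l1 + (l2 + l3), l))
  (F1 : 'M[R]_(m, n1)) (F2 : 'M[R]_(m, n2))
  (V1 : 'M[R]_(m, m1)) (V2 : 'M[R]_(m, m2)) (V3 : 'M[R]_(m, m3)) :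
  let Vs := wongVlim E A B in
  let Ws := wongWlim E A B in
  let T := row_mx UT (row_mx RT OT) in
  let FP := row_mx F1 (row_mx F2 0) in
  let V := row_mx V1 (row_mx V2 V3) in
  let P23 : 'M[R]_(l2 + l3, l1 + (l2 + l3)) := row_mx 0 1%:M in
  let P3 : 'M[R]_(l3, l1 + (l2 + l3)) := row_mx 0 (row_mx 0 1%:M) in
  [/\ full_col_rank UT, full_col_rank RT & full_col_rank OT] ->
  [/\ full_col_rank US, full_col_rank RS & full_col_rank OS] ->
  im UT = (Vs :&: Ws)%VS ->
  directv (im RT + im UT) -> (im RT + im UT)%VS = Vs ->
  directv (im OT + im RT + im UT) -> (im OT + im RT + im UT)%VS = fullv ->
  im US = (lmx E @: Vs :&: (lmx A @: Ws + im B))%VS ->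
  directv (im RS + im US) -> (im RS + im US)%VS = (lmx E @: Vs)%VS ->
  directv (im OS + im RS + im US) -> (im OS + im RS + im US)%VS = fullv ->
  (im B <= im (row_mx US OS))%VS ->
  is_inverse S (row_mx US (row_mx RS OS)) ->
  P23 *m S *m (A *m UT + B *m F1) = 0 ->
  P3 *m S *m (A *m RT + B *m F2) = 0 ->
  [/\ full_col_rank V1, full_col_rank V2 & full_col_rank V3] ->
  directv (im V1 + im V2 + im V3) -> (im V1 + im V2 + im V3)%VS = fullv ->
  im V2 = ker B ->
  im (row_mx V1 V2) = ker (P3 *m S *m B) ->
  QPFF (S *m E *m T) (S *m (A *m T + B *m FP)) (S *m B *m V).

Proof.
move=> Vs Ws T FP V P23 P3 [rUT rRT rOT] [rUS rRS rOS] imUT dirRU sumRU dirT sumT.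
move=> imUS dirRUS sumRUS dirS sumS imB [SK KS].
rewrite {}/T {}/FP {}/V {}/P3 {}/P23.
have [S1 [S2 [S3 SE]]] : exists S1 S2 S3, S = col_mx S1 (col_mx S2 S3).
  by exists (usubmx S), (usubmx (dsubmx S)), (dsubmx (dsubmx S)); rewrite !vsubmxK.
subst S; rewrite !mul_row_col !mul0mx !mul1mx !add0r mul_col_mx.
rewrite -[0 in X in X -> _]col_mx0 => /eq_col_mx[S2F1 S3F1] S3F2.
move=> [rV1 rV2 rV3] dirV sumV imV2 imV12.
move: SK; rewrite mul_col_row scalar_mx_block => /eq_block_mx[S1U].
rewrite mul_mx_row -row_mx0 => /eq_row_mx[S1R S1O].
rewrite mul_col_mx -col_mx0 => /eq_col_mx[S2U S3U].
rewrite mul_col_row scalar_mx_block => /eq_block_mx[S2R S2O S3R S3O].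
rewrite !mul_row_col in KS.
(* Expansion along [[US, RS, OS]]: [S1], [S2], [S3] read off the coordinates. *)
have decomp p (M : 'M_(l, p)) : M = US *m (S1 *m M) + (RS *m (S2 *m M) + OS *m (S3 *m M)).
  by rewrite !mulmxA -!mulmxDl KS mul1mx.
have V_E x : x \in Vs -> S3 *m (E *m x) = 0.
  move=> Vx; have : E *m x \in (im RS + im US)%VS.
    by rewrite sumRUS; apply/memv_lmx_imgP; exists x.
  case/memv_addP => _ /memv_limgP[a ->] [_ /memv_limgP[b ->] Ex].
  by rewrite Ex mulmxDr !mulmxA S3R S3U !mul0mx addr0.
have UTP x : reflect (exists a, x = UT *m a) ((x \in Vs) && (x \in Ws)).
  by rewrite -memv_cap -imUT; apply: memv_limgP.
have RT_V a : RT *m a \in Vs.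
  by rewrite -sumRU memvE (subv_trans _ (addvSl _ _)) // -memvE; apply/memv_limgP; exists a.
have UT_VW a : UT *m a \in Vs /\ UT *m a \in Ws.
  by apply/andP/UTP; exists a.
(* [im US] is the image under [E] of the intersection of the limits: if [E x] lies in [A W + im B],
   the fixed-point property puts [x] itself in [W]. *)
have US_P y : y \in im US <-> exists2 x, (x \in Vs) && (x \in Ws) & y = E *m x.
  rewrite imUS memv_cap; split.
    case/andP => /memv_lmx_imgP[x Vx ->] /memv_addP[_ /memv_lmx_imgP[w Ww ->]].
    case=> _ /memv_limgP[u ->] Ex; exists x => //.
    by rewrite Vx; apply/mem_wongWlim_fix; exists w, u.
  case=> x /andP[Vx /mem_wongWlim_fix[w [u [Ww Ex]]]] ->; apply/andP; split.
    by apply/memv_lmx_imgP; exists x.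
  rewrite Ex; apply: memv_add; last by apply/memv_limgP; exists u.
  by apply/memv_lmx_imgP; exists w.
have S2EU : S2 *m E *m UT = 0.
  apply: mulmx_cV_eq0 => a; have : E *m (UT *m a) \in im US.
    by apply/US_P; exists (UT *m a) => //; apply/andP/UT_VW.
  by case/memv_limgP => b EUb; rewrite -!mulmxA EUb mulmxA S2U mul0mx.
have S3EU : S3 *m E *m UT = 0.
  by apply: mulmx_cV_eq0 => a; rewrite -!mulmxA V_E //; case: (UT_VW a).
have S3ER : S3 *m E *m RT = 0.
  by apply: mulmx_cV_eq0 => a; rewrite -!mulmxA V_E.
have S2B : S2 *m B = 0.
  apply: mulmx_cV_eq0 => u.
  have /(subvP imB) : B *m u \in im B by apply/memv_limgP; exists u.
  rewrite limg_row_mx => /memv_addP[_ /memv_limgP[a ->]] [_ /memv_limgP[b ->] Bu].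
  by rewrite -mulmxA Bu mulmxDr !mulmxA S2U S2O !mul0mx addr0.
have BV2 : B *m V2 = 0.
  apply: mulmx_cV_eq0 => a; rewrite -mulmxA; apply/memv_lmx_kerP.
  by rewrite -imV2; apply/memv_limgP; exists a.
have S3BV1 : S3 *m B *m V1 = 0.
  apply: mulmx_cV_eq0 => a; rewrite -(mulmxA _ V1); apply/memv_lmx_kerP.
  rewrite -imV12 limg_row_mx memvE (subv_trans _ (addvSl _ _)) // -memvE.
  by apply/memv_limgP; exists a.
have /directv_addP capRU := dirRU.
(* The hypothesis gives directness with [OT] and [RT] grouped; the regrouped form says that [im OT]
   meets [Vs] trivially. *)
have capORU : (im OT :&: (im RT + im UT) = 0)%VS.
  move: dirT; rewrite directv_addE => /and3P[/directv_addP capOR _ /eqP capORU].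
  apply/eqP; rewrite -subv0; apply/subvP => x /memv_capP[Ox /memv_addP[y Ry [z Uz xE]]].
  have z0 : z = 0.
    apply: (memv_cap0 capORU) Uz.
    have -> : z = x + - y by rewrite xE addrC addKr.
    by apply: memv_add; rewrite ?memvN.
  by rewrite memv0 (memv_cap0 capOR Ox) // xE z0 addr0.
have [capV12 capV123] : (im V1 :&: im V2 = 0)%VS /\ ((im V1 + im V2) :&: im V3 = 0)%VS.
  by move: dirV; rewrite directv_addE => /and3P[/directv_addP ? _ /eqP ?].
set A' := A *m row_mx UT (row_mx RT OT) + B *m row_mx F1 (row_mx F2 0).
(* The feedback vanishes on the third block column, hence [A *m OT] without a [B] term. *)
exists (S1 *m E *m UT), (S1 *m (A *m UT + B *m F1)), (S1 *m E *m RT), (S1 *m (A *m RT + B *m F2)),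
  (S1 *m E *m OT), (S1 *m A *m OT), (S2 *m E *m RT), (S2 *m (A *m RT + B *m F2)),
  (S2 *m E *m OT), (S2 *m A *m OT), (S3 *m E *m OT), (S3 *m A *m OT),
  (S1 *m B *m V1), (S1 *m B *m V3), (S3 *m B *m V3).
split.
  split.
  - by rewrite !mul_col_mx !mul_mx_row S2EU S3EU S3ER.
  - rewrite /A' !mul_mx_row !mulmx0 !add_row_mx addr0 !mul_col_mx !mul_mx_row.
    by rewrite S2F1 S3F1 S3F2 !mulmxA.
  - rewrite !mul_col_mx !mul_mx_row S2B S3BV1.
    by rewrite -!(mulmxA _ B V2) BV2 !mulmx0 !mul0mx.
split.
- apply: QPFF1_of_wongWlim.
  + apply: mulmx_surj_rank => y.
    have /US_P[_ /UTP[x ->] Uy] : US *m y \in im US by apply/memv_limgP; exists y.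
    by exists x; rewrite -!mulmxA -Uy mulmxA S1U mul1mx.
  (* The other two coordinates of [B V1 a] vanish anyway, so [V1 a] lies in [ker B = im V2]. *)
  + apply: mulmx_inj_rank => a S1BV1a; apply: (full_col_rank_inj rV1).
    have V1a : V1 *m a \in im V1 by apply/memv_limgP; exists a.
    apply: (memv_cap0 capV12 V1a); rewrite imV2; apply/memv_lmx_kerP.
    rewrite [LHS]decomp [S1 *m _]mulmxA [S2 *m _]mulmxA [S3 *m _]mulmxA.
    rewrite S2B mul0mx [S1 *m B *m _]mulmxA S1BV1a [S3 *m B *m _]mulmxA S3BV1.
    by rewrite mul0mx !mulmx0 !addr0.
  + apply/vspaceP => x; rewrite memvf; apply/idP.
    have [_ UTx] := UT_VW x; set W11 := wongWlim _ _ _.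
    (* The induction runs over all of [Ws], as predecessors are not known to lie in [im UT]
       beforehand; they do when [y] is in [im UT], by the fixed-point property of [Vs]. *)
    suff H : forall y, y \in Ws -> y \in Ws /\ forall a, y = UT *m a -> a \in W11.
      by apply: (H _ UTx).2.
    apply: wongWlim_ind => {x UTx} [|w y u [Ww IHw] Ey].
      split=> [|a /esym /(full_col_rank_inj rUT) ->]; exact: mem0v.
    split=> [|a ya]; first by apply/mem_wongWlim_fix; exists w, u.
    have Vw : w \in Vs.
      have [Va _] := UT_VW a; apply/mem_wongVlim_fix; exists (UT *m a), (- u); split=> //.
      by rewrite -ya Ey mulmxN addrK.
    have /UTP[b wb] : (w \in Vs) && (w \in Ws) by rewrite Vw.
    have {}Ey : E *m y = (A *m UT + B *m F1) *m b + B *m (u - F1 *m b).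
      by rewrite Ey wb mulmxDl mulmxBr -!mulmxA -addrA [_ + (_ - _)]addrC subrK.
    (* After absorbing the feedback, the new input lies in [ker (S3 B) = im [V1, V2]]; [B] kills its
       [V2] part, and its [V1] coordinates [c] serve as input of the first block. *)
    have S3Bu : S3 *m B *m (u - F1 *m b) = 0.
      have : S3 *m (E *m y) = 0 by rewrite V_E // ya; case: (UT_VW a).
      by rewrite Ey mulmxDr !mulmxA S3F1 mul0mx add0r.
    have /memv_addP[_ /memv_limgP[c ->] [_ /memv_limgP[d ->] uE]] :
        u - F1 *m b \in (im V1 + im V2)%VS.
      by rewrite -limg_row_mx imV12; apply/memv_lmx_kerP.
    apply/mem_wongWlim_fix; exists b, c; split; first exact: IHw.
    rewrite -(mulmxA _ UT) -(mulmxA S1) -ya Ey uE (mulmxDr B).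
    rewrite [B *m (V2 *m d)]mulmxA BV2 mul0mx addr0.
    by rewrite mulmxDr !mulmxA.
- have rE22 : \rank (S2 *m E *m RT) = l2.
    apply: mulmx_surj_rank => y.
    have : RS *m y \in (lmx E @: Vs)%VS.
      by rewrite -sumRUS memvE (subv_trans _ (addvSl _ _)) // -memvE; apply/memv_limgP; exists y.
    case/memv_lmx_imgP => x; rewrite -sumRU.
    case/memv_addP => _ /memv_limgP[b ->] [_ /memv_limgP[a ->] ->] Ry.
    exists b; rewrite -[RHS]mul1mx -S2R -(mulmxA _ RS) Ry !mulmxDr !mulmxA S2EU mul0mx addr0 //.
  have rE22' : \rank (S2 *m E *m RT) = n2.
    apply: mulmx_inj_rank => b; rewrite -!mulmxA => S2b; apply: (full_col_rank_inj rRT).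
    have RTb : RT *m b \in im RT by apply/memv_limgP; exists b.
    apply: (memv_cap0 capRU RTb); rewrite imUT memv_cap RT_V /=.
    (* Only the [US] coordinate of [E RT b] survives, so it equals [E v] with [v] in [Ws].
       Membership in [Ws] depends only on the image under [E], so [RT b] is in [Ws] too. *)
    have /US_P[v /andP[Vv Wv] Ev] : E *m (RT *m b) \in im US.
      rewrite [X in X \in _]decomp S2b V_E ?RT_V // !mulmx0 !addr0.
      by apply/memv_limgP; eexists; reflexivity.
    have /mem_wongWlim_fix[w [u [Ww Ew]]] := Wv.
    by apply/mem_wongWlim_fix; exists w, u; rewrite Ev.
  split; first by rewrite -rE22 rE22'.
  have /row_freeP[M EM] : row_free (S2 *m E *m RT) by rewrite /row_free rE22.
  have /row_fullP[N NE] : row_full (S2 *m E *m RT) by rewrite /row_full rE22'.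
  exists M; split=> //.
  by rewrite -[M]mul1mx -NE -(mulmxA N) EM mulmx1.
- apply: QPFF3_of_wongVlim.
    apply: mulmx_inj_rank => c; rewrite -(mulmxA _ V3) => S3c; apply: (full_col_rank_inj rV3).
    apply: (memv_cap0 capV123); last by apply/memv_limgP; exists c.
    by rewrite -limg_row_mx imV12; apply/memv_lmx_kerP.
  apply/eqP; rewrite -subv0; apply/subvP => x Vx; rewrite memv0; apply/eqP.
  apply: (full_col_rank_inj rOT).
  have OTx : OT *m x \in im OT by apply/memv_limgP; exists x.
  suff: OT *m x \in Vs.
    by rewrite -sumRU; apply: memv_cap0 capORU OTx.
  apply/memVlim => i; elim: i x Vx {OTx} => [|i IHi] x Vx; first exact: memvf.
  have /mem_wongVlim_fix[y [u [/IHi Vy Ax]]] := Vx.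
  (* The relation in the third block lifts only modulo [ker S3], which is [E Vs]. Writing the defect
     as [E v] with [v] in [Vs] corrects the predecessor to [OT y + v], still in [V^i]. *)
  set r := A *m (OT *m x) - (E *m (OT *m y) + B *m (V3 *m u)).
  have S3r : S3 *m r = 0 by rewrite /r mulmxBr mulmxDr !mulmxA Ax subrr.
  have : r \in (lmx E @: Vs)%VS.
    rewrite -sumRUS [r]decomp S3r mulmx0 addr0 addrC.
    by apply: memv_add; apply/memv_limgP; eexists; reflexivity.
  case/memv_lmx_imgP => v /memVlim Vv rE.
  apply/mem_wongVS; exists (OT *m y + v), (V3 *m u); split; first exact: memvD.
  by rewrite mulmxDr -rE /r addrAC addrC subrK.
Qed.
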